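(* Let $m\ge 2$ be an even integer and let $f:[0,\infty)\to[0,\infty)$ be $m$-radical convex. Then, for all $a,b>0$ and $0\le t\le 1$, $$\begin{aligned}(1-t)f(a)+tf(b)&\ge \sum_{k=0}^{m/2}f\left(\binom{m/2}{k}^{\frac1m}(t(1-t))^{\frac km}|a-b|^{\frac{2k}{m}}\big((1-t)a+tb\big)^{1-\frac{2k}{m}}\right)\\&=f((1-t)a+tb)+\sum_{k=1}^{m/2}f\left(\binom{m/2}{k}^{\frac1m}(t(1-t))^{\frac km}|a-b|^{\frac{2k}{m}}\big((1-t)a+tb\big)^{1-\frac{2k}{m}}\right).\end{aligned}$$ In particular, for all $a,b>0$, $$\frac{f(a)+f(b)}{2}\ge \sum_{k=0}^{m/2}f\left(\binom{m/2}{k}^{\frac1m}\left(\frac{a+b}{2}\right)^{\frac{2k}{m}}\left(\frac{|a-b|}{2}\right)^{1-\frac{2k}{m}}\right).$$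
   Context: Let $p\ge 1$. A continuous function $f:[0,\infty)\to[0,\infty)$ with $f(0)=0$ is called $p$-radical convex if the function $x\mapsto f\left(x^{1/p}\right)$ is convex on $[0,\infty)$. Convention: $0^0=1$. *)

(* Defs.v *)
From HB Require Import structures.
From mathcomp Require Import all_boot all_order all_algebra.
From mathcomp Require Import all_classical all_reals all_analysis.
Export Order.TTheory GRing.Theory Num.Theory.
Export numFieldNormedType.Exports.

Set Implicit Arguments.
Unset Strict Implicit.
Unset Printing Implicit Defensive.

Local Open Scope classical_set_scope.
Local Open Scope ring_scope.

(* A function [0, oo) -> [0, oo) is represented by a total f : R -> R of which
   only the values on [0, oo) are constrained. *)
Definition radical_convex (R : realType) (p : R) (f : R -> R) : Prop :=
  [/\ 1 <= p,
      {within `[0, +oo[, continuous f},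
      forall x : R, 0 <= x -> 0 <= f x,
      f 0 = 0
    & convex_function (`[0, +oo[ : set R^o) (fun x : R^o => f (x `^ (1 / p)))].

(* Main.v *)
(* Put g x = f (x^(1/m)) and n = m/2. Being convex with g 0 = 0 and g >= 0, g is
   superadditive and nondecreasing on [0, oo). Convexity of g, then of x^n, gives
   (1-t) f a + t f b >= g ((1-t) a^m + t b^m) >= g (((1-t) a^2 + t b^2)^n),
   and (1-t) a^2 + t b^2 = t (1-t) (a-b)^2 + ((1-t) a + t b)^2. Expanding the n-th
   power of this sum by the binomial theorem, superadditivity bounds the right-hand
   side below by the sum of the values of g at the binomial terms. The midpoint
   inequality lists the same terms, at t = 1/2, in the opposite order. *)
Require Import Defs.
From HB Require Import structures.
From mathcomp Require Import all_boot all_order all_algebra.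
From mathcomp Require Import all_classical all_reals all_analysis.
From mathcomp Require Import ring lra.

Set Implicit Arguments.
Unset Strict Implicit.
Unset Printing Implicit Defensive.

Local Open Scope ring_scope.

Section ConvexHalfLine.
Context {R : realType}.
Implicit Types (g : R -> R) (x y t : R).

Lemma convex_halfline g x y t :
  convex_function (`[0, +oo[%classic : set R^o) (g : R^o -> R^o) ->
  0 <= x -> 0 <= y -> 0 <= t <= 1 ->
  g ((1 - t) * x + t * y) <= (1 - t) * g x + t * g y.
Proof.
move=> g_conv x0 y0 /andP[t0 t1].
(* The endpoints are swapped because convex combinations here put the weight [t] on the first
   point. *)
have := g_conv (Itv01 t0 t1) y x.
rewrite !inE /= !in_itv /= x0 y0 => /(_ isT isT).
by rewrite addrC [leRHS]addrC.
Qed.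

Variable g : R -> R.
Hypothesis g_conv :
  convex_function (`[0, +oo[%classic : set R^o) (g : R^o -> R^o).
Hypothesis g0 : g 0 = 0.

(** On [[0, x + y]] the graph of [g] lies below its chord through the origin ([star]); adding the
    chord bounds at [x] and [y] gives [g (x + y)]. The chord slope divides by [x + y], so the zero
    case is separate. *)
Lemma convex_superadditive x y : 0 <= x -> 0 <= y -> g x + g y <= g (x + y).
Proof.
move=> x0 y0; have [xy0|xy0] := eqVneq (x + y) 0.
  have [-> ->] : x = 0 /\ y = 0 by split; lra.
  by rewrite addr0 g0 addr0.
have s_gt0 : 0 < x + y by rewrite lt_def xy0 addr_ge0.
have star z : 0 <= z <= x + y -> g z <= z / (x + y) * g (x + y).
  move=> /andP[z0 zs].
  have := @convex_halfline g 0 (x + y) (z / (x + y)) g_conv (lexx _) (ltW s_gt0).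
  rewrite mulr0 add0r g0 mulr0 add0r divfK //; apply.
  by rewrite divr_ge0 ?(ltW s_gt0) //= ler_pdivrMr // mul1r.
apply: le_trans (lerD (star x _) (star y _)) _; try by lra.
by rewrite -mulrDl -mulrDl divff // mul1r.
Qed.

Lemma convex_superadditive_sum (F : nat -> R) n : (forall k, 0 <= F k) ->
  \sum_(0 <= k < n) g (F k) <= g (\sum_(0 <= k < n) F k).
Proof.
move=> F0; elim: n => [|n IHn]; first by rewrite !big_geq // g0.
rewrite !big_nat_recr //=; apply: le_trans (convex_superadditive _ _) => //.
  by rewrite lerD2r.
exact: sumr_ge0.
Qed.

Hypothesis g_ge0 : forall x, 0 <= x -> 0 <= g x.

(** By superadditivity, [g y] exceeds [g x] by at least [g (y - x)], which is nonnegative. *)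
Lemma convex_nondecreasing x y : 0 <= x -> x <= y -> g x <= g y.
Proof.
move=> x0 xy; have yx0 : 0 <= y - x by rewrite subr_ge0.
have := convex_superadditive x0 yx0.
by rewrite subrKC; apply: le_trans; rewrite lerDl g_ge0.
Qed.

End ConvexHalfLine.

Lemma convex_exprn (R : realType) (n : nat) (x y t : R) :
  0 <= x -> 0 <= y -> 0 <= t <= 1 ->
  ((1 - t) * x + t * y) ^+ n.+1 <= (1 - t) * x ^+ n.+1 + t * y ^+ n.+1.
Proof.
move=> x0 y0 t01; have /andP[t0 t1] := t01.
have n1 : 1 <= n.+1%:R :> R by rewrite ler1n.
have := convex_halfline (convex_powR n1) x0 y0 t01.
by rewrite !powR_mulrn // addr_ge0 ?mulr_ge0 ?subr_ge0.
Qed.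

(** This and the next two lemmas turn each real power into an [m]-th root of a natural power, so
    that [powRM] can merge the factors of a term under one root. *)
Lemma powR_natdiv (R : realType) (m k : nat) (x : R) : 0 <= x ->
  x `^ (k%:R / m%:R) = (x ^+ k) `^ (1 / m%:R).
Proof. by move=> x0; rewrite div1r powRrM powR_mulrn. Qed.

Lemma powR_2natdiv (R : realType) (m k : nat) (x : R) : 0 <= x ->
  x `^ (2 * k%:R / m%:R) = ((x ^+ 2) ^+ k) `^ (1 / m%:R).
Proof. by move=> x0; rewrite -natrM powR_natdiv // exprM. Qed.

Lemma powR_1sub2natdiv (R : realType) (n k : nat) (x : R) :
  (0 < n)%N -> (k <= n)%N -> 0 <= x ->
  x `^ (1 - 2 * k%:R / n.*2%:R) = ((x ^+ 2) ^+ (n - k)) `^ (1 / n.*2%:R).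
Proof.
move=> n0 kn x0; rewrite -powR_2natdiv //; congr (_ `^ _).
have : n%:R != 0 :> R by rewrite pnatr_eq0 -lt0n.
by rewrite natrB // -mul2n natrM => ?; field.
Qed.

(** The summands [y] and [z] stay abstract so that both inequalities are instances, with the roles
    of the squared mean and the squared difference exchanged. *)
Lemma radical_convex_binomial (R : realType) (n : nat) (f : R -> R)
    (a b t y z : R) :
  (0 < n)%N -> radical_convex n.*2%:R f ->
  0 <= a -> 0 <= b -> 0 <= t <= 1 -> 0 <= y -> 0 <= z ->
  y + z = (1 - t) * a ^+ 2 + t * b ^+ 2 ->
  \sum_(0 <= k < n.+1)
     f (('C(n, k)%:R * y ^+ k * z ^+ (n - k)) `^ (1 / n.*2%:R))
    <= (1 - t) * f a + t * f b.
Proof.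
move=> n0 [_ _ f_ge0 f0 f_conv] a0 b0 t01 y0 z0 yz.
pose g x := f (x `^ (1 / n.*2%:R)).
have m0 : n.*2%:R != 0 :> R by rewrite pnatr_eq0 double_eq0 -lt0n.
have g0 : g 0 = 0 by rewrite /g powR0 // div1r invr_eq0.
have g_ge0 x : 0 <= x -> 0 <= g x by move=> _; rewrite f_ge0 ?powR_ge0.
have gX x : 0 <= x -> g (x ^+ n.*2) = f x.
  by move=> x0; rewrite /g -powR_natdiv // divff // powRr1.
have /andP[t0 t1] := t01.
have term0 k : 0 <= 'C(n, k)%:R * y ^+ k * z ^+ (n - k).
  by rewrite !mulr_ge0 ?ler0n ?exprn_ge0.
apply: le_trans (convex_superadditive_sum f_conv g0 n.+1 term0) _.
rewrite -(gX a) // -(gX b) //.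
apply: le_trans (convex_halfline f_conv _ _ t01); rewrite ?exprn_ge0 //.
apply: (convex_nondecreasing f_conv g0 g_ge0); first exact: sumr_ge0.
have -> : \sum_(0 <= k < n.+1) 'C(n, k)%:R * y ^+ k * z ^+ (n - k)
          = (y + z) ^+ n.
  rewrite addrC exprDn big_mkord; apply: eq_bigr => k _.
  by rewrite -[RHS]mulr_natl mulrA mulrAC.
(* Reading [a ^+ n.*2] as [(a ^+ 2) ^+ n] leaves convexity of the [n]-th power at the squares of [a]
   and [b]. *)
rewrite yz -mul2n !exprM -(prednK n0).
by apply: convex_exprn; rewrite ?exprn_ge0.
Qed.

Theorem theorem3p2 (R : realType) (m : nat) (f : R -> R)
    (m_ge2 : (2 <= m)%N) (m_even : ~~ odd m)
    (f_rc : radical_convex m%:R f) :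
  (forall a b t : R, 0 < a -> 0 < b -> 0 <= t <= 1 ->
     (1 - t) * f a + t * f b >=
       \sum_(0 <= k < (m./2).+1)
         f ('C(m./2, k)%:R `^ (1 / m%:R)
            * (t * (1 - t)) `^ (k%:R / m%:R)
            * `|a - b| `^ (2 * k%:R / m%:R)
            * ((1 - t) * a + t * b) `^ (1 - 2 * k%:R / m%:R))
  /\
     \sum_(0 <= k < (m./2).+1)
       f ('C(m./2, k)%:R `^ (1 / m%:R)
          * (t * (1 - t)) `^ (k%:R / m%:R)
          * `|a - b| `^ (2 * k%:R / m%:R)
          * ((1 - t) * a + t * b) `^ (1 - 2 * k%:R / m%:R))
     = f ((1 - t) * a + t * b)
       + \sum_(1 <= k < (m./2).+1)
           f ('C(m./2, k)%:R `^ (1 / m%:R)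
              * (t * (1 - t)) `^ (k%:R / m%:R)
              * `|a - b| `^ (2 * k%:R / m%:R)
              * ((1 - t) * a + t * b) `^ (1 - 2 * k%:R / m%:R)))
  /\
  (forall a b : R, 0 < a -> 0 < b ->
     (f a + f b) / 2 >=
       \sum_(0 <= k < (m./2).+1)
         f ('C(m./2, k)%:R `^ (1 / m%:R)
            * ((a + b) / 2) `^ (2 * k%:R / m%:R)
            * (`|a - b| / 2) `^ (1 - 2 * k%:R / m%:R))).
Proof.
move: m_ge2 f_rc; rewrite -(even_halfK m_even); move: m./2 => n.
rewrite doubleK => n_ge1 f_rc'.
have n0 : (0 < n)%N by move: n_ge1; case: (n).
have m0 : n.*2%:R != 0 :> R by rewrite pnatr_eq0 double_eq0 -lt0n.
split=> [a b t a0 b0 t01|a b a0 b0].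
  have /andP[t0 t1] := t01.
  have T0 : 0 <= t * (1 - t) by rewrite mulr_ge0 ?subr_ge0.
  have M0 : 0 <= (1 - t) * a + t * b.
    by rewrite addr_ge0 ?mulr_ge0 ?subr_ge0 // ltW.
  split; last first.
    (* In the term [k = 0], [powRr0] covers base zero too ([t] at an endpoint or [a = b]), in line
       with the convention for zero to the power zero. *)
    rewrite big_ltn // bin0 powR1 mulr0 !mul0r !powRr0 subr0 powRr1 //.
    by rewrite !mul1r.
  apply: le_trans (radical_convex_binomial (y := t * (1 - t) * `|a - b| ^+ 2)
    (z := ((1 - t) * a + t * b) ^+ 2) n0 f_rc' (ltW a0) (ltW b0) t01 _ _ _).
  (* [big_nat] retains the bound [k <= n], without which [n - k] would be truncated. *)
  - rewrite big_nat [leRHS]big_nat ler_sum // => k /andP[_ kn].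
    rewrite powR_natdiv // powR_2natdiv // powR_1sub2natdiv //.
    by rewrite -!powRM ?mulr_ge0 ?exprn_ge0 // [in leRHS]exprMn mulrA.
  - by rewrite mulr_ge0 ?exprn_ge0.
  - by rewrite exprn_ge0.
  - by rewrite real_normK ?num_real //; ring.
have M0 : 0 <= (a + b) / 2 by lra.
have D0 : 0 <= `|a - b| / 2 by rewrite divr_ge0.
have half01 : 0 <= (2^-1 : R) <= 1 by lra.
have -> : (f a + f b) / 2 = (1 - 2^-1) * f a + 2^-1 * f b by field.
(* Taking the squared mean as [y] reverses the order of the terms; the factor [t (1 - t) = 1/4] is
   absorbed into the square of [|a - b| / 2]. *)
apply: le_trans (radical_convex_binomial (y := ((a + b) / 2) ^+ 2)
  (z := (`|a - b| / 2) ^+ 2) n0 f_rc' (ltW a0) (ltW b0) half01 _ _ _).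
- rewrite big_nat [leRHS]big_nat ler_sum // => k /andP[_ kn].
  rewrite powR_2natdiv // powR_1sub2natdiv //.
  by rewrite -!powRM ?mulr_ge0 ?exprn_ge0.
- by rewrite exprn_ge0.
- by rewrite exprn_ge0.
- by rewrite [X in _ + X]expr_div_n real_normK ?num_real //; field.
Qed.
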